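(* For an arbitrary Riemannian manifold $(M,g)$ of dimension $n\geq 4$, $$h_4=|W|^2+2(n-2)(n-3)\,\sigma_2 .$$ In particular, $\sigma_2>0$ (resp. $\sigma_2\geq 0$) implies $h_4>0$ (resp. $h_4\geq 0$).
   Context: $R$, $Ric$, $Scal$ denote the covariant Riemann tensor, Ricci tensor and scalar curvature. Norms of $(2,2)$ double forms (such as $R$ and the Weyl tensor $W$) are $|R|^2=\sum_{i<j,\,k<l}R_{ijkl}^2$ in an orthonormal basis (a quarter of the full tensor norm squared), and $|Ric|^2=\sum_{i,j}Ric_{ij}^2$. The second Gauss–Bonnet curvature is $h_4=|R|^2-|Ric|^2+\frac14 Scal^2$ (equivalently $\frac{1}{4!}c^4R^2$ with $R^2$ the exterior, i.e. Kulkarni–Nomizu, square of $R$ as a $(2,2)$ double form and $c$ the contraction). The Schouten tensor is $A=\frac{1}{n-2}\bigl(Ric-\frac{Scal}{2(n-1)}g\bigr)$, $W$ is the Weyl tensor defined by $R=W+gA$ ($gA$ the Kulkarni–Nomizu product), and $\sigma_2$ is the second elementary symmetric function of the eigenvalues of $A$ with respect to $g$. *)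

(* Defs.v *)
From HB Require Import structures.
From mathcomp Require Import all_boot all_order all_algebra.
From mathcomp Require Import all_classical all_reals all_analysis.

Set Implicit Arguments.
Unset Strict Implicit.
Unset Printing Implicit Defensive.

Import Order.TTheory GRing.Theory Num.Theory.
Import numFieldNormedType.Exports.

Local Open Scope classical_set_scope.
Local Open Scope ring_scope.

Definition partial (R : realType) (n : nat) (V : normedModType R) (i : 'I_n)
    (f : 'rV[R]_n -> V) (x : 'rV[R]_n) : V :=
  'D_(delta_mx 0 i) f x.

(* Only used for an open set U, so continuity at each point of U is the same
   as continuity of the restriction to U. *)
Fixpoint Ck_on (R : realType) (n : nat) (V : normedModType R) (k : nat)
    (U : set 'rV[R]_n) (f : 'rV[R]_n -> V) : Prop :=
  (forall x, U x -> {for x, continuous f}) /\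
  match k with
  | 0 => True
  | k'.+1 => forall i : 'I_n,
      (forall x, U x -> derivable f x (delta_mx 0 i)) /\
      Ck_on k' U (partial i f)
  end.

Definition smooth_on (R : realType) (n : nat) (V : normedModType R)
    (U : set 'rV[R]_n) (f : 'rV[R]_n -> V) : Prop :=
  forall k, Ck_on k U f.

(* coord and param are total functions, meaningful on dom and on the image
   coord @` dom respectively, where they are mutually inverse. *)
Record chart (R : realType) (n : nat) (M : topologicalType) := Chart {
  dom : set M;
  coord : M -> 'rV[R]_n;
  param : 'rV[R]_n -> M;
  dom_open : open dom;
  image_open : open (coord @` dom);
  coordK : forall p, dom p -> param (coord p) = p;
  coord_continuous : {within dom, continuous coord};
  param_continuous : {within coord @` dom, continuous param} }.

Definition overlap (R : realType) (n : nat) (M : topologicalType)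
    (a b : chart R n M) : set 'rV[R]_n :=
  coord a @` (dom a `&` dom b).

Definition transition (R : realType) (n : nat) (M : topologicalType)
    (a b : chart R n M) : 'rV[R]_n -> 'rV[R]_n :=
  fun x => coord b (param a x).

Record smooth_manifold (R : realType) (n : nat) := SmoothManifold {
  carrier :> topologicalType;
  carrier_hausdorff : hausdorff_space carrier;
  carrier_second_countable : @second_countable carrier;
  atlas : set (chart R n carrier);
  atlas_cover : forall p : carrier, exists2 a, atlas a & dom a p;
  atlas_smooth : forall a b, atlas a -> atlas b ->
    smooth_on (overlap a b) (transition a b) }.

(* A metric is given by its matrices (g_ij) in the charts of the atlas. The
   library's Jacobian acts on row vectors, 'J f x i j = d_i f_j (x), so
   metric_transition is g^a_ij = sum_kl (d_i y_k) (d_j y_l) g^b_kl, where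
   y = transition a b. *)
Record riemannian_metric (R : realType) (n : nat) (M : smooth_manifold R n) :=
  RiemannianMetric {
  metric :> chart R n M -> 'rV[R]_n -> 'M[R]_n;
  metric_smooth : forall a, atlas a -> smooth_on (coord a @` dom a) (metric a);
  metric_sym : forall a, atlas a -> forall x, (coord a @` dom a) x ->
    (metric a x)^T = metric a x;
  metric_posdef : forall a, atlas a -> forall x, (coord a @` dom a) x ->
    forall v : 'rV[R]_n, v != 0 -> 0 < (v *m metric a x *m v^T) 0 0;
  metric_transition : forall a b, atlas a -> atlas b ->
    forall x, overlap a b x ->
    metric a x = 'J (transition a b) x *m metric b (transition a b x)
                   *m ('J (transition a b) x)^T }.

(* Components, in the coordinate basis, of a tensor with four lower indices. *)
Definition tensor4 (R : realType) (n : nat) := 'I_n -> 'I_n -> 'I_n -> 'I_n -> R.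

(* christoffel G k i j = Gamma^k_ij, for the Levi-Civita connection. *)
Definition christoffel (R : realType) (n : nat) (G : 'rV[R]_n -> 'M[R]_n)
    (k i j : 'I_n) (x : 'rV[R]_n) : R :=
  2^-1 * \sum_(l < n) invmx (G x) k l *
    (partial i (fun y => G y j l) x + partial j (fun y => G y i l) x
     - partial l (fun y => G y i j) x).

(* The d_m-component of Rm(d_i, d_j) d_k, where
   Rm(X, Y) Z = nabla_X nabla_Y Z - nabla_Y nabla_X Z - nabla_[X,Y] Z. *)
Definition curvature_op (R : realType) (n : nat) (G : 'rV[R]_n -> 'M[R]_n)
    (x : 'rV[R]_n) (m i j k : 'I_n) : R :=
  partial i (christoffel G m j k) x - partial j (christoffel G m i k) x
  + \sum_(p < n) (christoffel G m i p x * christoffel G p j k x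
                  - christoffel G m j p x * christoffel G p i k x).

(* R_ijkl = g(Rm(d_i, d_j) d_l, d_k): with this sign R_ijij is the sectional
   curvature in an orthonormal basis, and the unit sphere has R = (1/2) g g. *)
Definition riemann (R : realType) (n : nat) (G : 'rV[R]_n -> 'M[R]_n)
    (x : 'rV[R]_n) : tensor4 R n :=
  fun i j k l => \sum_(m < n) G x k m * curvature_op G x m i j l.

Definition ricci (R : realType) (n : nat) (G : 'rV[R]_n -> 'M[R]_n)
    (x : 'rV[R]_n) : 'M[R]_n :=
  \matrix_(j, l) \sum_(i < n) \sum_(k < n) invmx (G x) i k * riemann G x i j k l.

Definition scal (R : realType) (n : nat) (G : 'rV[R]_n -> 'M[R]_n)
    (x : 'rV[R]_n) : R :=
  \sum_(j < n) \sum_(l < n) invmx (G x) j l * ricci G x j l.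

Definition schouten (R : realType) (n : nat) (G : 'rV[R]_n -> 'M[R]_n)
    (x : 'rV[R]_n) : 'M[R]_n :=
  (n%:R - 2)^-1 *: (ricci G x - (scal G x / (2 * (n%:R - 1))) *: G x).

(* Kulkarni-Nomizu product. *)
Definition kn_prod (R : realType) (n : nat) (h k : 'M[R]_n) : tensor4 R n :=
  fun i j r s => h i r * k j s + h j s * k i r - h i s * k j r - h j r * k i s.

Definition weyl (R : realType) (n : nat) (G : 'rV[R]_n -> 'M[R]_n)
    (x : 'rV[R]_n) : tensor4 R n :=
  fun i j k l => riemann G x i j k l - kn_prod (G x) (schouten G x) i j k l.

(* Row a of E lists the coordinate components of the a-th frame vector. *)
Definition orthonormal (R : realType) (n : nat) (h E : 'M[R]_n) : Prop :=
  E *m h *m E^T = 1%:M.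

Definition frame4 (R : realType) (n : nat) (E : 'M[R]_n) (T : tensor4 R n) :
    tensor4 R n :=
  fun a b c d => \sum_(i < n) \sum_(j < n) \sum_(k < n) \sum_(l < n)
    E a i * E b j * E c k * E d l * T i j k l.

Definition normsq22 (R : realType) (n : nat) (E : 'M[R]_n) (T : tensor4 R n) : R :=
  \sum_(i < n) \sum_(j < n | (i < j)%N) \sum_(k < n) \sum_(l < n | (k < l)%N)
    frame4 E T i j k l ^+ 2.

Definition normsq11 (R : realType) (n : nat) (E h : 'M[R]_n) : R :=
  \sum_(i < n) \sum_(j < n) (E *m h *m E^T) i j ^+ 2.

(* The eigenvalues listed with multiplicity; meaningful when the
   characteristic polynomial splits over R. *)
Definition eigenvalues (R : realType) (n : nat) (A : 'M[R]_n) : seq R :=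
  xget [::] [set s : seq R | char_poly A = \prod_(t <- s) ('X - t%:P)].

Definition elem_sym2 (R : realType) (s : seq R) : R :=
  \sum_(i < size s) \sum_(j < size s | (i < j)%N) s`_i * s`_j.

(* Everything is computed at a point p in the domain of a chart c; E is a
   basis of the tangent space at p, expressed in the coordinates of c. *)

Definition orthonormal_basis (R : realType) (n : nat) (M : smooth_manifold R n)
    (g : riemannian_metric M) (c : chart R n M) (p : M) (E : 'M[R]_n) : Prop :=
  orthonormal (g c (coord c p)) E.

Definition h4 (R : realType) (n : nat) (M : smooth_manifold R n)
    (g : riemannian_metric M) (c : chart R n M) (p : M) (E : 'M[R]_n) : R :=
  normsq22 E (riemann (g c) (coord c p)) - normsq11 E (ricci (g c) (coord c p))
  + 4^-1 * scal (g c) (coord c p) ^+ 2.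

Definition weyl_normsq (R : realType) (n : nat) (M : smooth_manifold R n)
    (g : riemannian_metric M) (c : chart R n M) (p : M) (E : 'M[R]_n) : R :=
  normsq22 E (weyl (g c) (coord c p)).

(* The eigenvalues of A with respect to g are those of g^-1 A. *)
Definition sigma2 (R : realType) (n : nat) (M : smooth_manifold R n)
    (g : riemannian_metric M) (c : chart R n M) (p : M) : R :=
  elem_sym2 (eigenvalues
    (invmx (g c (coord c p)) *m schouten (g c) (coord c p))).

(* Main.v *)
Require Import Defs.
From mathcomp Require Import all_boot all_order all_algebra.
From mathcomp Require Import all_classical all_reals all_analysis.
From mathcomp Require Import ring lra spectral.
From mathcomp.real_closed Require Import complex.

Set Implicit Arguments.
Unset Strict Implicit.
Unset Printing Implicit Defensive.

Import Order.TTheory GRing.Theory Num.Theory.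
Import numFieldNormedType.Exports.

Local Open Scope classical_set_scope.
Local Open Scope ring_scope.

(** Everything happens at one point, in an orthonormal frame, where the curvature
    tensor R is an array R_abcd antisymmetric in (a, b) and in (c, d), the metric
    g is the identity matrix, and the Ricci tensor and the scalar curvature are
    successive contractions of R.

    The Schouten tensor A is defined so that the product gA has the same Ricci
    contraction as R, namely Ric = (n - 2) A + (tr A) g ([schouten_inversion],
    [ricci_contraction_kn_prod]). Thus W = R - gA has zero contraction. Since the
    product with g is adjoint to the contraction ([dot_kn_prod]), W is orthogonal
    to gA, and
      |R|^2 = |W|^2 + (n - 2) |A|^2 + (tr A)^2.
    Moreover |Ric|^2 = (n - 2)^2 |A|^2 + (3n - 4) (tr A)^2 and
    Scal = 2 (n - 1) tr A, so that
      h_4 = |W|^2 + (n - 2) (n - 3) ((tr A)^2 - |A|^2).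
    As A is symmetric, it is diagonalizable with real eigenvalues and
    (tr A)^2 - |A|^2 is twice their second elementary symmetric function
    ([sigma2_frame]). The sign statements follow because |W|^2 is nonnegative and
    (n - 2) (n - 3) is positive.

    Two facts about R come from its definition by the Christoffel symbols of a
    metric: the antisymmetry in the last two indices, without which the norm and
    the adjunction above would fail, and the symmetry of Ric, hence of A. Both
    follow from the antisymmetry in the first two indices and from the pair
    symmetry R_ijkl = R_klij ([riemann_pair_sym]). The latter is read off the
    expression of R by second derivatives of the metric ([riemannE]); it rests on
    the equality of mixed partial derivatives ([schwarz]), proved with the mean
    value theorem. *)

(** * Symmetry of second partial derivatives *)

(** Reduces a directional derivative to one of a real function of one variable,
    where the mean value theorem applies. *)
Lemma is_derive_line (R : realType) (V : normedModType R) (f : V -> R)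
    (y v : V) (a : R) :
  derivable f (y + a *: v) v ->
  is_derive a 1 (fun t : R => f (y + t *: v)) ('D_v f (y + a *: v)).
Proof.
move=> df.
have E : (fun h : R => h^-1 *: (((fun t : R => f (y + t *: v)) \o shift a) (h *: 1)
             - f (y + a *: v)))
    = (fun h : R => h^-1 *: ((f \o shift (y + a *: v)) (h *: v) - f (y + a *: v))).
  apply/funext => h /=; rewrite [h%:A]mulr1.
  by rewrite scalerDl [X in f X]addrCA.
by split; rewrite /derivable /derive E.
Qed.

(** The second difference of [f] on the parallelogram spanned by [s *: u] and
    [s *: v] is the increment over [0, s] of a difference of values of [f];
    the mean value theorem in the direction [u], then in the direction [v],
    turns it into a mixed derivative at an interior point. *)
Lemma mixed_increment (R : realType) (V : normedModType R) (f : V -> R)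
    (x u v : V) (s : R) :
  0 < s ->
  (forall a b, a \in `[0, s] -> b \in `[0, s] ->
     derivable f (x + a *: u + b *: v) u) ->
  (forall a b, a \in `[0, s] -> b \in `[0, s] ->
     derivable ('D_u f) (x + a *: u + b *: v) v) ->
  exists a b, [/\ a \in `]0, s[, b \in `]0, s[ &
    f (x + s *: u + s *: v) - f (x + s *: u) - f (x + s *: v) + f x
    = s ^+ 2 * 'D_v ('D_u f) (x + a *: u + b *: v)].
Proof.
move=> s0 df ddf.
have s_in : s \in `[0, s] by rewrite in_itv /= lexx ltW.
have z_in : (0 : R) \in `[0, s] by rewrite in_itv /= lexx ltW.
have oc (t : R) : t \in `]0, s[ -> t \in `[0, s].
  by rewrite !in_itv /= => /andP[? ?]; rewrite !ltW.
pose phi (a : R) := f (x + s *: v + a *: u) - f (x + a *: u).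
pose dphi (a : R) := 'D_u f (x + s *: v + a *: u) - 'D_u f (x + a *: u).
have dP a : a \in `[0, s] -> is_derive a 1 phi (dphi a).
  move=> ai; apply: is_deriveB.
    by apply: is_derive_line; rewrite addrAC; exact: df.
  by apply: is_derive_line; have := df a 0 ai z_in; rewrite scale0r addr0.
have cphi : {within `[0, s], continuous phi}.
  by apply: derivable_within_continuous => t ti; case: (dP t ti).
have [a ai Ea] := @MVT R phi dphi 0 s s0 (fun t ti => dP t (oc t ti)) cphi.
pose psi (b : R) := 'D_u f (x + a *: u + b *: v).
pose dpsi (b : R) := 'D_v ('D_u f) (x + a *: u + b *: v).
have dQ b : b \in `[0, s] -> is_derive b 1 psi (dpsi b).
  by move=> bi; apply: is_derive_line; apply: ddf => //; exact: oc.
have cpsi : {within `[0, s], continuous psi}.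
  by apply: derivable_within_continuous => t ti; case: (dQ t ti).
have [b bi Eb] := @MVT R psi dpsi 0 s s0 (fun t ti => dQ t (oc t ti)) cpsi.
exists a, b; split => //.
move: Ea Eb; rewrite /phi /dphi /psi !scale0r !addr0 subr0.
rewrite [x + s *: v + s *: u]addrAC [x + s *: v + a *: u]addrAC => Ea Eb.
by rewrite expr2 -mulrA [s * ('D_v _ _)]mulrC -Eb [RHS]mulrC -Ea; ring.
Qed.

Lemma dist_le_half (R : realFieldType) (e x y z : R) :
  `|x - z| < e / 2 -> `|y - z| < e / 2 -> `|x - y| <= e.
Proof.
move=> xz yz; rewrite (le_trans (ler_distD z _ _)) // [leRHS]splitr lerD //.
  exact: ltW.
by rewrite distrC ltW.
Qed.

(** The second difference does not see the order of [u] and [v], so by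
    [mixed_increment] the two mixed derivatives agree at two points of the
    parallelogram; shrinking it to [x] and continuity give equality at [x]. *)
Lemma schwarz (R : realType) (V : normedModType R) (f : V -> R) (x u v : V) :
  (\forall y \near x, derivable f y u) ->
  (\forall y \near x, derivable f y v) ->
  (\forall y \near x, derivable ('D_u f) y v) ->
  (\forall y \near x, derivable ('D_v f) y u) ->
  {for x, continuous ('D_v ('D_u f))} ->
  {for x, continuous ('D_u ('D_v f))} ->
  'D_v ('D_u f) x = 'D_u ('D_v f) x.
Proof.
move=> du dv duv dvu cuv cvu.
apply/eqP; rewrite -subr_eq0 -normr_eq0 eq_le normr_ge0 andbT.
apply/ler_addgt0Pr => e e0; rewrite add0r.
have e2 : 0 < e / 2 by rewrite divr_gt0.
have nuv : \forall y \near x, `|'D_v ('D_u f) x - 'D_v ('D_u f) y| < e / 2.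
  exact: (cvgrPdist_lt _ _).1 cuv _ e2.
have nvu : \forall y \near x, `|'D_u ('D_v f) x - 'D_u ('D_v f) y| < e / 2.
  exact: (cvgrPdist_lt _ _).1 cvu _ e2.
have nH : nbhs x (((derivable f)^~ u `&` (derivable f)^~ v
     `&` ((derivable ('D_u f))^~ v `&` (derivable ('D_v f))^~ u))
     `&` ((fun t : V => `|'D_v ('D_u f) x - 'D_v ('D_u f) t| < e / 2)
          `&` (fun t : V => `|'D_u ('D_v f) x - 'D_u ('D_v f) t| < e / 2))).
  exact: (filterI (filterI (filterI du dv) (filterI duv dvu)) (filterI nuv nvu)).
have [r /= r0 rP] := (nbhs_ballP _ _).1 nH.
(* The side s is chosen so that the whole parallelogram lies in the ball of
   radius r; the 1 in m covers the case u = v = 0. *)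
pose m := `|u| + `|v| + 1.
have m0 : 0 < m by rewrite ltr_wpDl // addr_ge0.
pose s := r / m.
have s0 : 0 < s by rewrite divr_gt0.
have inr (a b : R) : a \in `[0, s] -> b \in `[0, s] ->
    ball x r (x + a *: u + b *: v).
  rewrite !in_itv /= => /andP[a0 as_] /andP[b0 bs].
  rewrite -ball_normE /ball_ /= -addrA opprD addNKr normrN.
  rewrite (le_lt_trans (ler_normD _ _)) // !normrZ (ger0_norm a0) (ger0_norm b0).
  have : a * `|u| + b * `|v| <= s * (`|u| + `|v|).
    by rewrite mulrDr lerD // ler_wpM2r.
  move/le_lt_trans; apply; rewrite /s mulrAC ltr_pdivrMr // ltr_pM2l // /m.
  by rewrite ltrDl.
have oc (t : R) : t \in `]0, s[ -> t \in `[0, s].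
  by rewrite !in_itv /= => /andP[? ?]; rewrite !ltW.
have [a [b [ai bi Eab]]] := mixed_increment s0
  (fun a b ai bi => (rP _ (inr a b ai bi)).1.1.1)
  (fun a b ai bi => (rP _ (inr a b ai bi)).1.2.1).
have inr' c d (ci : c \in `[0, s]) (di : d \in `[0, s]) :
    ball x r (x + c *: v + d *: u) by rewrite addrAC; exact: inr.
have [c [d [ci di Ecd]]] := mixed_increment s0
  (fun c d ci di => (rP _ (inr' c d ci di)).1.1.2)
  (fun c d ci di => (rP _ (inr' c d ci di)).1.2.2).
have Eq : 'D_v ('D_u f) (x + a *: u + b *: v) = 'D_u ('D_v f) (x + c *: v + d *: u).
  apply: (mulfI (lt0r_neq0 (exprn_gt0 2 s0))).
  apply: (etrans (esym Eab)); apply: (etrans _ Ecd).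
  have Ef := congr1 f (addrAC x (s *: u) (s *: v)).
  apply: (congr1 (fun z => z + f x)).
  exact: (etrans (addrAC _ _ _)
    (congr1 (fun z => z - f (x + s *: v) - f (x + s *: u)) Ef)).
have [_ [/= n1 _]] := rP _ (inr a b (oc _ ai) (oc _ bi)).
have [_ [_ /= n2]] := rP _ (inr' c d (oc _ ci) (oc _ di)).
by rewrite -Eq in n2; exact: dist_le_half n1 n2.
Qed.

(** * Functions of class C^k on an open set *)

Lemma near_open (T : topologicalType) (U : set T) (x : T) (P : T -> Prop) :
  open U -> U x -> (forall y, U y -> P y) -> \forall y \near x, P y.
Proof. by move=> oU Ux UP; apply: filterS UP _; exact: open_nbhs_nbhs. Qed.

Lemma Ck_on_eq (R : realType) (n : nat) (V : normedModType R) (k : nat)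
    (U : set 'rV[R]_n) (f g : 'rV[R]_n -> V) :
  open U -> (forall x, U x -> f x = g x) -> Ck_on k U f -> Ck_on k U g.
Proof.
move=> oU; elim: k f g => [|k IH] f g fg /= [cf dkf].
all: have nfg x (Ux : U x) : \forall y \near x, f y = g y by exact: near_open Ux fg.
all: have cg x (Ux : U x) : {for x, continuous g}.
1,3: by rewrite /prop_for /continuous_at -(fg x Ux);
  exact: cvg_trans (near_eq_cvg (nfg x Ux)) (cf x Ux).
  by [].
split=> // i; have [df kf] := dkf i.
split=> [x Ux|]; first exact: (near_eq_derivable (nfg x Ux) (df x Ux)).
by apply: IH kf => x Ux; exact: near_eq_derive (nfg x Ux).
Qed.

(** The derivatives of a matrix-valued metric are taken in the space of
    matrices, those in the Christoffel symbols entry by entry; this lemma passes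
    from the first to the second, at every order. *)
Lemma Ck_on_entry (R : realType) (n p q : nat) (k : nat)
    (U : set 'rV[R]_n) (M : 'rV[R]_n -> 'M[R]_(p, q)) (a : 'I_p) (b : 'I_q) :
  open U -> Ck_on k U M -> Ck_on k U (fun x => M x a b).
Proof.
move=> oU.
have ce (N : 'rV[R]_n -> 'M[R]_(p, q)) x :
    {for x, continuous N} -> {for x, continuous (fun y => N y a b)}.
  move=> cN; apply: (@continuous_comp _ _ _ N (fun A : 'M[R]_(p, q) => A a b)) => //.
  exact: coord_continuous.
elim: k M => [|k IH] M /= [cM dM]; split => //; try by move=> x /cM; exact: ce.
move=> i; have [dMi kMi] := dM i; split=> [x Ux|].
  by have /derivable_mxP := dMi x Ux; exact.
apply: (Ck_on_eq oU _ (IH _ kMi)) => x Ux.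
by rewrite /partial derive_mx ?mxE //; exact: dMi.
Qed.

Lemma derivable_big_sum (R : realType) (V : normedModType R) (I : Type) (r : seq I)
    (P : pred I) (F : I -> V -> R) x v :
  (forall i, derivable (F i) x v) ->
  derivable (fun y => \sum_(i <- r | P i) F i y) x v.
Proof.
move=> dF; elim: r => [|i r IH].
  by under eq_fun do rewrite big_nil; exact: derivable_cst.
under eq_fun do rewrite big_cons; case: (P i); last exact: IH.
exact: (derivableD (dF i) IH).
Qed.

Lemma derive_big_sum (R : realType) (V : normedModType R) (n : nat)
    (F : 'I_n -> V -> R) x v :
  (forall i, derivable (F i) x v) ->
  'D_v (fun y => \sum_(i < n) F i y) x = \sum_(i < n) 'D_v (F i) x.
Proof.
move=> dF; rewrite -derive_sum //; congr ('D_v _ x).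
by apply/funext => y; rewrite fct_sumE.
Qed.

Lemma derivable_big_prod (R : realType) (V : normedModType R) (I : Type) (r : seq I)
    (P : pred I) (F : I -> V -> R) x v :
  (forall i, derivable (F i) x v) ->
  derivable (fun y => \prod_(i <- r | P i) F i y) x v.
Proof.
move=> dF; elim: r => [|i r IH].
  by under eq_fun do rewrite big_nil; exact: derivable_cst.
under eq_fun do rewrite big_cons; case: (P i); last exact: IH.
exact: (derivableM (dF i) IH).
Qed.

Lemma derivable_det (R : realType) (V : normedModType R) (n : nat)
    (M : V -> 'M[R]_n) x v :
  (forall i j, derivable (fun y => M y i j) x v) ->
  derivable (fun y => \det (M y)) x v.
Proof.
move=> dM; apply: derivable_big_sum => s.
by apply: derivableM; [exact: derivable_cst|exact: derivable_big_prod].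
Qed.

(** Cramer's rule: an entry of the inverse is a polynomial in the entries of [M]
    divided by the determinant. *)
Lemma derivable_invmx (R : realType) (V : normedModType R) (n : nat)
    (M : V -> 'M[R]_n) x v (a b : 'I_n) :
  (\forall y \near x, M y \in unitmx) ->
  (forall i j, derivable (fun y => M y i j) x v) ->
  derivable (fun y => invmx (M y) a b) x v.
Proof.
move=> uM dM.
have uE : \forall y \near x, (\det (M y))^-1 * cofactor (M y) b a = invmx (M y) a b.
  by apply: filterS uM => y uMy; rewrite /invmx uMy !mxE.
suff d : derivable (fun y => (\det (M y))^-1 * cofactor (M y) b a) x v.
  exact: near_eq_derivable uE d.
apply: derivableM.
  apply: derivableV; last exact: derivable_det.
  by rewrite -unitfE -unitmxE; exact: nbhs_singleton uM.
apply: derivableM; first exact: derivable_cst.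
by apply: derivable_det => i j; under eq_fun do rewrite !mxE; exact: dM.
Qed.

Lemma partialC (R : realType) (n : nat) (U : set 'rV[R]_n) (f : 'rV[R]_n -> R)
    (i j : 'I_n) (x : 'rV[R]_n) :
  open U -> Ck_on 2 U f -> U x ->
  partial i (partial j f) x = partial j (partial i f) x.
Proof.
move=> oU [_ Cf] Ux.
have near_x (Q : 'rV[R]_n -> Prop) : (forall y, U y -> Q y) -> \forall y \near x, Q y.
  exact: near_open.
have [[di [_ Ci]] [dj [_ Cj]]] := (Cf i, Cf j).
have [[dij [cij _]] [dji [cji _]]] := (Ci j, Cj i).
exact: (@schwarz R _ f x (delta_mx 0 j) (delta_mx 0 i) (near_x _ dj) (near_x _ di)
  (near_x _ dji) (near_x _ dij) (cji x Ux) (cij x Ux)).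
Qed.

(** * Pair symmetry of the Riemann tensor *)

(** In this section [G] is the matrix of a metric in a chart with image [U].
    Lowering the upper index of the curvature makes the second derivatives of
    [G] appear linearly, and leaves a quadratic term in the Christoffel symbols
    of the first kind; both parts are visibly symmetric under the exchange of
    the two pairs of indices. *)
Section Riemann.
Variables (R : realType) (n : nat) (U : set 'rV[R]_n) (G : 'rV[R]_n -> 'M[R]_n).
Hypothesis openU : open U.
Hypothesis smoothG : smooth_on U G.
Hypothesis symG : forall x, U x -> (G x)^T = G x.
Hypothesis unitG : forall x, U x -> G x \in unitmx.

Let gE x a b : U x -> G x a b = G x b a.
Proof. by move=> Ux; rewrite -[in LHS]symG // mxE. Qed.

Let partial_eq x (f h : 'rV[R]_n -> R) i : U x -> (forall y, U y -> f y = h y) ->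
  partial i f x = partial i h x.
Proof. by move=> Ux fh; apply: near_eq_derive; exact: near_open Ux fh. Qed.

Definition dmetric (i a b : 'I_n) : 'rV[R]_n -> R := partial i (fun y => G y a b).

Let Cg a b : Ck_on 2 U (fun y => G y a b).
Proof. by apply: Ck_on_entry => //; exact: smoothG. Qed.

Let dg x i a b : U x -> derivable (fun y => G y a b) x (delta_mx 0 i).
Proof. by move=> Ux; have [_ /(_ i)[d _]] := Cg a b; exact: d. Qed.

Let ddg x j i a b : U x -> derivable (dmetric i a b) x (delta_mx 0 j).
Proof. by move=> Ux; have [_ /(_ i)[_ [_ /(_ j)[d _]]]] := Cg a b; exact: d. Qed.

Let dmetric_sym x i a b : U x -> dmetric i a b x = dmetric i b a x.
Proof. by move=> Ux; apply: partial_eq => // y Uy; exact: gE. Qed.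

Let ddmetric_sym x j i a b : U x ->
  partial j (dmetric i a b) x = partial j (dmetric i b a) x.
Proof. by move=> Ux; apply: partial_eq => // y Uy; exact: dmetric_sym. Qed.

Let ddmetricC x j i a b : U x ->
  partial j (dmetric i a b) x = partial i (dmetric j a b) x.
Proof. by move=> Ux; exact: (partialC j i openU (Cg a b) Ux). Qed.

(** Christoffel symbols of the first kind. *)
Definition christoffel1 (k i j : 'I_n) (x : 'rV[R]_n) : R :=
  2^-1 * (dmetric i j k x + dmetric j i k x - dmetric k i j x).

Lemma christoffelE k i j x :
  christoffel G k i j x = \sum_m invmx (G x) k m * christoffel1 m i j x.
Proof.
rewrite /christoffel mulr_sumr; apply: eq_bigr => m _.
by rewrite /christoffel1 /dmetric mulrCA.
Qed.

Lemma lower_christoffel k i j x : U x ->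
  \sum_m G x k m * christoffel G m i j x = christoffel1 k i j x.
Proof.
move=> Ux.
transitivity (\sum_q (G x *m invmx (G x)) k q * christoffel1 q i j x).
  under eq_bigr do rewrite christoffelE mulr_sumr.
  rewrite exchange_big; apply: eq_bigr => q _ /=.
  by rewrite mxE mulr_suml; apply: eq_bigr => m _; rewrite mulrA.
rewrite mulmxV ?unitG // (bigD1 k) //= mxE eqxx mul1r big1 ?addr0 // => q qk.
by rewrite mxE eq_sym (negbTE qk) mul0r.
Qed.

Lemma christoffel1_sym k i j x : U x -> christoffel1 k i j x = christoffel1 k j i x.
Proof. by move=> Ux; rewrite /christoffel1 (dmetric_sym k i j Ux); ring. Qed.

Lemma christoffel_sym k i j x : U x -> christoffel G k i j x = christoffel G k j i x.
Proof.
move=> Ux; rewrite !christoffelE; apply: eq_bigr => m _.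
by rewrite christoffel1_sym.
Qed.

(** The covariant derivative of the metric vanishes. *)
Lemma metric_compatible i k m x : U x ->
  dmetric i k m x = christoffel1 k i m x + christoffel1 m i k x.
Proof.
move=> Ux; rewrite /christoffel1 (dmetric_sym i m k Ux) (dmetric_sym m i k Ux).
by rewrite (dmetric_sym k i m Ux); field.
Qed.

Let dchr1 l k i j x : U x ->
  derivable (christoffel1 k i j) x (delta_mx 0 l).
Proof.
move=> Ux; apply: derivableM; first exact: derivable_cst.
by apply: derivableB; [apply: derivableD|]; exact: ddg.
Qed.

Lemma partial_christoffel1 l k i j x : U x ->
  partial l (christoffel1 k i j) x = 2^-1 *
    (partial l (dmetric i j k) x + partial l (dmetric j i k) x
     - partial l (dmetric k i j) x).
Proof.
move=> Ux.
have dD : derivable (fun y => dmetric i j k y + dmetric j i k y) x (delta_mx 0 l).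
  by apply: derivableD; exact: ddg.
rewrite /partial /christoffel1.
rewrite (deriveMl _ (derivableB dD (@ddg x l k i j Ux))).
rewrite (deriveB dD (@ddg x l k i j Ux)).
by rewrite (deriveD (@ddg x l i j k Ux) (@ddg x l j i k Ux)).
Qed.

Let dchr l k i j x : U x -> derivable (christoffel G k i j) x (delta_mx 0 l).
Proof.
move=> Ux.
have -> : christoffel G k i j = fun y => \sum_m invmx (G y) k m * christoffel1 m i j y.
  by apply/funext => y; exact: christoffelE.
apply: derivable_big_sum => m; apply: derivableM; last exact: dchr1.
apply: derivable_invmx; last by move=> a b; exact: dg.
exact: near_open Ux unitG.
Qed.

(** Product rule applied to [lower_christoffel], which holds on the whole of [U]. *)
Lemma lower_partial_christoffel l k i j x : U x ->
  \sum_m G x k m * partial l (christoffel G m i j) x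
  = partial l (christoffel1 k i j) x
    - \sum_m dmetric l k m x * christoffel G m i j x.
Proof.
move=> Ux; apply/eqP; rewrite eq_sym subr_eq; apply/eqP.
rewrite -(partial_eq l Ux (fun y Uy => lower_christoffel k i j Uy)).
rewrite /partial derive_big_sum; last by move=> m; apply: derivableM; [exact: dg|exact: dchr].
rewrite -big_split; apply: eq_bigr => m _ /=.
rewrite (deriveM (@dg x l k m Ux) (@dchr l m i j x Ux)) /dmetric /partial.
by congr (_ + _); exact: mulrC.
Qed.

(** The inner product, for the inverse metric, of [christoffel1 _ i k] and
    [christoffel1 _ j l]; the inverse matrix is hidden in [christoffel]. *)
Definition christoffel_dot (x : 'rV[R]_n) (i k j l : 'I_n) : R :=
  \sum_m christoffel1 m i k x * christoffel G m j l x.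

Lemma christoffel_dotC x i k j l : U x ->
  christoffel_dot x i k j l = christoffel_dot x j l i k.
Proof.
move=> Ux; rewrite /christoffel_dot.
under eq_bigr do rewrite christoffelE mulr_sumr.
rewrite exchange_big; apply: eq_bigr => q _ /=.
rewrite christoffelE mulr_sumr; apply: eq_bigr => m _.
have -> : invmx (G x) m q = invmx (G x) q m.
  by rewrite -[in RHS](symG Ux) -trmx_inv mxE.
by ring.
Qed.

(** The classical expression of the covariant curvature tensor by second
    derivatives of the metric. The products of Christoffel symbols in the
    curvature operator cancel against a part of the terms produced by
    differentiating the metric ([metric_compatible]), which leaves the two
    inner products; the derivatives [partial i (dmetric j l k)] and
    [partial j (dmetric i l k)] cancel by the Schwarz theorem. *)
Lemma riemannE x i j k l : U x ->
  riemann G x i j k l =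
    2^-1 * (partial i (dmetric l j k) x + partial j (dmetric k i l) x
            - partial i (dmetric k j l) x - partial j (dmetric l i k) x)
    - christoffel_dot x i k j l + christoffel_dot x j k i l.
Proof.
move=> Ux.
have quad a b : \sum_m G x k m * (\sum_p christoffel G m a p x * christoffel G p b l x)
    = \sum_p christoffel1 k a p x * christoffel G p b l x.
  under eq_bigr do rewrite mulr_sumr.
  rewrite exchange_big; apply: eq_bigr => p _ /=.
  rewrite -(lower_christoffel k a p Ux) mulr_suml.
  by apply: eq_bigr => m _; rewrite mulrA.
have split_metric a b : \sum_m dmetric a k m x * christoffel G m b l x
    = \sum_p christoffel1 k a p x * christoffel G p b l x + christoffel_dot x a k b l.
  rewrite /christoffel_dot -big_split; apply: eq_bigr => m _ /=.
  by rewrite (metric_compatible a k m Ux) mulrDl.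
pose sub (s t : R) := s - t.
have lower a b : \sum_m G x k m * partial a (christoffel G m b l) x
    = 2^-1 * (partial a (dmetric b l k) x + partial a (dmetric l b k) x
              - partial a (dmetric k b l) x)
      - (\sum_p christoffel1 k a p x * christoffel G p b l x
         + christoffel_dot x a k b l).
  apply: (etrans (lower_partial_christoffel a k b l Ux)).
  exact (f_equal2 sub (partial_christoffel1 a k b l Ux) (split_metric a b)).
have -> : riemann G x i j k l =
  \sum_m G x k m * partial i (christoffel G m j l) x
  - \sum_m G x k m * partial j (christoffel G m i l) x
  + (\sum_m G x k m * (\sum_p christoffel G m i p x * christoffel G p j l x)
  - \sum_m G x k m * (\sum_p christoffel G m j p x * christoffel G p i l x)).
  rewrite /riemann -!sumrB -big_split; apply: eq_bigr => m _ /=.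
  by rewrite /curvature_op sumrB mulrDr !mulrBr.
(* Stated for arbitrary reals, so that no tactic has to compare derivatives
   up to conversion. *)
have collect (A A' B B' C C' Q Q' S S' : R) : A = A' ->
    (2^-1 * (A + B - C) - (Q + S)) - (2^-1 * (A' + B' - C') - (Q' + S')) + (Q - Q')
    = 2^-1 * (B + C' - C - B') - S + S'.
  by move=> ->; field.
apply: (etrans _ (collect _ _ _ _ _ _ _ _ _ _ (ddmetricC i j l k Ux))).
exact: (f_equal2 +%R (f_equal2 sub (lower i j) (lower j i))
                     (f_equal2 sub (quad i j) (quad j i))).
Qed.

(** The exchange of (i, j) with (k, l) permutes the second derivatives in
    [riemannE] two by two, by the Schwarz theorem and the symmetry of the metric,
    and fixes each of the two inner products. *)
Lemma riemann_pair_sym x i j k l : U x -> riemann G x i j k l = riemann G x k l i j.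
Proof.
move=> Ux.
have ddpair a b c d : partial a (dmetric b c d) x = partial b (dmetric a d c) x.
  by rewrite (ddmetricC a b c d Ux) (ddmetric_sym b a c d Ux).
have dotpair a b c d : christoffel_dot x a b c d = christoffel_dot x b a d c.
  apply: eq_bigr => m _.
  by rewrite (christoffel_sym m c d Ux) (christoffel1_sym m a b Ux).
have collect (B1 B2 B3 B4 B1' B2' B3' B4' S S' T T' : R) :
    B1 = B2' -> B2 = B1' -> B3 = B3' -> B4 = B4' -> S = S' -> T = T' ->
    2^-1 * (B1 + B2 - B3 - B4) - S + T = 2^-1 * (B1' + B2' - B3' - B4') - S' + T'.
  by move=> -> -> -> -> -> ->; rewrite (addrC B2').
have dotswap : christoffel_dot x j k i l = christoffel_dot x l i k j.
  by rewrite (christoffel_dotC j k i l Ux) (dotpair i l j k).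
rewrite (riemannE i j k l Ux) (riemannE k l i j Ux).
exact (collect _ _ _ _ _ _ _ _ _ _ _ _ (ddpair i l j k) (ddpair j k i l)
  (ddpair i k j l) (ddpair j l i k) (dotpair i k j l) dotswap).
Qed.

End Riemann.

Lemma riemann_antisym12 (R : realType) n (G : 'rV[R]_n -> 'M[R]_n) x i j k l :
  riemann G x j i k l = - riemann G x i j k l.
Proof.
rewrite /riemann -sumrN; apply: eq_bigr => m _; rewrite -mulrN; congr (_ * _).
by rewrite /curvature_op !sumrB opprD !opprB.
Qed.

(** The Ricci tensor is the contraction of the first and third indices, which
    the pair symmetry exchanges along with the second and the fourth. *)
Lemma ricci_sym (R : realType) (n : nat) (G : 'rV[R]_n -> 'M[R]_n) x :
  (G x)^T = G x ->
  (forall i j k l, riemann G x i j k l = riemann G x k l i j) ->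
  (ricci G x)^T = ricci G x.
Proof.
move=> symG pairR; apply/matrixP => l j; rewrite !mxE.
rewrite exchange_big; apply: eq_bigr => k _; apply: eq_bigr => i _.
by rewrite pairR; congr (_ * _); rewrite -[in RHS]symG -trmx_inv mxE.
Qed.

(** * Tensors in an orthonormal frame *)

Definition bivector_antisym (R : realType) (n : nat) (T : tensor4 R n) : Prop :=
  (forall i j k l, T j i k l = - T i j k l) /\
  (forall i j k l, T i j l k = - T i j k l).

(** With the next three lemmas, this reduces a frame computation for a
    Kulkarni-Nomizu product to [frame4_tensor]. *)
Lemma frame4_swap12 (R : realType) n (E : 'M[R]_n) (T : tensor4 R n) a b c d :
  frame4 E (fun i j k l => T j i k l) a b c d = frame4 E T b a c d.
Proof.
rewrite /frame4 exchange_big /=; apply: eq_bigr => i _; apply: eq_bigr => j _.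
by apply: eq_bigr => k _; apply: eq_bigr => l _; rewrite (mulrC (E a j)).
Qed.

Lemma frame4_swap34 (R : realType) n (E : 'M[R]_n) (T : tensor4 R n) a b c d :
  frame4 E (fun i j k l => T i j l k) a b c d = frame4 E T a b d c.
Proof.
rewrite /frame4; apply: eq_bigr => i _; apply: eq_bigr => j _.
rewrite exchange_big /=.
by apply: eq_bigr => k _; apply: eq_bigr => l _; rewrite (mulrAC _ (E c l)).
Qed.

Lemma frame4D (R : realType) n (E : 'M[R]_n) (S T : tensor4 R n) a b c d :
  frame4 E (fun i j k l => S i j k l + T i j k l) a b c d
  = frame4 E S a b c d + frame4 E T a b c d.
Proof.
rewrite /frame4 -big_split; apply: eq_bigr => i _; rewrite -big_split; apply: eq_bigr => j _.
by rewrite -big_split; apply: eq_bigr => k _; rewrite -big_split; apply: eq_bigr => l _; rewrite mulrDr.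
Qed.

Lemma frame4N (R : realType) n (E : 'M[R]_n) (T : tensor4 R n) a b c d :
  frame4 E (fun i j k l => - T i j k l) a b c d = - frame4 E T a b c d.
Proof.
rewrite /frame4 -sumrN; apply: eq_bigr => i _; rewrite -sumrN; apply: eq_bigr => j _.
by rewrite -sumrN; apply: eq_bigr => k _; rewrite -sumrN; apply: eq_bigr => l _; rewrite mulrN.
Qed.

Lemma mulmx_conjE (R : comNzRingType) n (E h : 'M[R]_n) a c :
  (E *m h *m E^T) a c = \sum_i \sum_k E a i * E c k * h i k.
Proof.
rewrite !mxE exchange_big /=; apply: eq_bigr => k _; rewrite !mxE mulr_suml.
by apply: eq_bigr => i _; ring.
Qed.

Lemma frame4_tensor (R : realType) n (E h k : 'M[R]_n) a b c d :
  frame4 E (fun i j r s => h i r * k j s) a b c d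
  = (E *m h *m E^T) a c * (E *m k *m E^T) b d.
Proof.
rewrite !mulmx_conjE mulr_suml; apply: eq_bigr => i _.
rewrite exchange_big mulr_suml; apply: eq_bigr => r _.
rewrite mulr_sumr; apply: eq_bigr => j _; rewrite mulr_sumr; apply: eq_bigr => s _.
by ring.
Qed.

Lemma frame4_kn_prod (R : realType) n (E h k : 'M[R]_n) a b c d :
  frame4 E (kn_prod h k) a b c d
  = kn_prod (E *m h *m E^T) (E *m k *m E^T) a b c d.
Proof.
pose P (h k : 'M[R]_n) : tensor4 R n := fun i j r s => h i r * k j s.
have -> : kn_prod h k = fun i j r s =>
    P h k i j r s + P h k j i s r + - P h k i j s r + - P h k j i r s.
  by do 4!apply/funext => ?.
rewrite !frame4D !frame4N (frame4_swap12 E (fun i j r s => P h k i j s r)).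
by rewrite (frame4_swap12 E (P h k)) !(frame4_swap34 E (P h k)) !frame4_tensor.
Qed.

Lemma exchange_big_pairs (R : nmodType) n (F : 'I_n -> 'I_n -> 'I_n -> 'I_n -> R) :
  \sum_i \sum_k \sum_j \sum_l F i k j l = \sum_j \sum_l \sum_i \sum_k F i k j l.
Proof.
transitivity (\sum_j \sum_i \sum_k \sum_l F i k j l).
  by rewrite [RHS]exchange_big; apply: eq_bigr => i _; exact: exchange_big.
apply: eq_bigr => j _; rewrite [RHS]exchange_big.
by apply: eq_bigr => i _; exact: exchange_big.
Qed.

(** In an orthonormal frame of the metric [h], the matrix [E^T *m E] is the
    inverse of [h] ([orthonormal_invmx]), so this says that the Ricci
    contraction commutes with passing to the frame. *)
Lemma frame4_trace (R : realType) n (E : 'M[R]_n) (T : tensor4 R n) b d :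
  \sum_a frame4 E T a b a d
  = (E *m (\matrix_(j, l) \sum_i \sum_k (E^T *m E) i k * T i j k l) *m E^T) b d.
Proof.
rewrite mulmx_conjE /frame4.
transitivity (\sum_a \sum_i \sum_k \sum_j \sum_l E a i * E a k * (E b j * E d l * T i j k l)).
  apply: eq_bigr => a _; apply: eq_bigr => i _; rewrite exchange_big.
  by apply: eq_bigr => k _; apply: eq_bigr => j _; apply: eq_bigr => l _; ring.
transitivity (\sum_i \sum_k \sum_j \sum_l (E^T *m E) i k * (E b j * E d l * T i j k l)).
  rewrite exchange_big; apply: eq_bigr => i _.
  rewrite exchange_big; apply: eq_bigr => k _.
  rewrite exchange_big; apply: eq_bigr => j _.
  rewrite exchange_big; apply: eq_bigr => l _.
  by rewrite -mulr_suml mxE; congr (_ * _); apply: eq_bigr => a _; rewrite mxE.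
transitivity (\sum_j \sum_l \sum_i \sum_k (E^T *m E) i k * (E b j * E d l * T i j k l)).
  exact: exchange_big_pairs.
apply: eq_bigr => j _; apply: eq_bigr => l _; rewrite mxE mulr_sumr.
by apply: eq_bigr => i _; rewrite mulr_sumr; apply: eq_bigr => k _; ring.
Qed.

Lemma frame4_antisym (R : realType) n (E : 'M[R]_n) (T : tensor4 R n) :
  bivector_antisym T -> bivector_antisym (frame4 E T).
Proof.
move=> [T12 T34]; split=> a b c d.
  rewrite -frame4_swap12 -frame4N; congr (frame4 E _ _ _ _ _).
  by do 4!apply/funext => ?; rewrite T12.
rewrite -frame4_swap34 -frame4N; congr (frame4 E _ _ _ _ _).
by do 4!apply/funext => ?; rewrite T34.
Qed.

Lemma orthonormal_invmx (R : realType) n (h E : 'M[R]_n) :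
  Defs.orthonormal h E -> invmx h = E^T *m E.
Proof.
rewrite /Defs.orthonormal -mulmxA => /mulmx1C; rewrite -mulmxA => hE.
have [uh _] := mulmx1_unit hE.
by rewrite -[LHS]mulmx1 -hE mulKmx.
Qed.

Lemma sum_pairs_symm (R : nzRingType) (n : nat) (F : 'I_n -> 'I_n -> R) :
  (forall i j, F i j = F j i) ->
  \sum_(i < n) \sum_(j < n) F i j
  = \sum_(i < n) F i i + 2 * \sum_(i < n) \sum_(j < n | (i < j)%N) F i j.
Proof.
move=> symF.
have -> : \sum_(i < n) \sum_(j < n) F i j = \sum_(i < n) F i i
    + (\sum_(i < n) \sum_(j < n | (i < j)%N) F i j
       + \sum_(i < n) \sum_(j < n | (j < i)%N) F i j).
  rewrite -!big_split; apply: eq_bigr => i _ /=.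
  rewrite (bigD1 i) //= (bigID (fun j : 'I_n => (i < j)%N)) /=.
  congr (_ + (_ + _)); apply: eq_bigl => j; rewrite -val_eqE /=;
    by case: ltngtP; rewrite ?andbT ?andbF.
congr (_ + _); rewrite mulrDl !mul1r; congr (_ + _).
rewrite (exchange_big_dep xpredT) //=; apply: eq_bigr => i _; apply: eq_bigr => j _.
exact: symF.
Qed.

(** * The elementary symmetric function of a symmetric endomorphism *)

Lemma char_poly_conj (F : fieldType) n (P A : 'M[F]_n) : P \in unitmx ->
  char_poly (invmx P *m A *m P) = char_poly A.
Proof.
move=> uP; rewrite /char_poly /char_poly_mx.
have -> : 'X%:M - map_mx polyC (invmx P *m A *m P)
   = map_mx polyC (invmx P) *m ('X%:M - map_mx polyC A) *m map_mx polyC P.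
  rewrite mulmxBr mulmxBl -!map_mxM; congr (_ - _).
  by rewrite mul_mx_scalar -scalemxAl -map_mxM mulVmx // map_mx1 scalemx1.
by rewrite !det_mulmx mulrAC -det_mulmx -map_mxM mulVmx // map_mx1 det1 mul1r.
Qed.

(** The spectral theorem over the complex numbers applies to a real symmetric
    matrix because it is Hermitian; its eigenvalues are real, and the embedding
    of the reals in the complex numbers being injective, the factorization of
    the characteristic polynomial and the two traces descend to the reals. *)
Lemma symmetric_char_poly_split (R : realType) n (S : 'M[R]_n) : S^T = S ->
  exists s : seq R, [/\ char_poly S = \prod_(t <- s) ('X - t%:P),
    \sum_(t <- s) t = \tr S & \sum_(t <- s) t ^+ 2 = \tr (S *m S)].
Proof.
move=> symS.
pose f : {rmorphism R -> R[i]} := real_complex R.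
pose A := map_mx f S.
have Ah : A \is sesquilinear.hermitianmx _ false Num.conj.
  apply/is_hermitianmxP; rewrite expr0 scale1r.
  apply/matrixP => i j; rewrite !mxE -[in LHS]symS mxE.
  by apply/esym/CrealP; exact/complex_realP/ex_intro.
have Dr := hermitian_spectral_diag_real Ah.
have /orthomx_spectralP EA := hermitian_normalmx Ah.
set P := spectralmx A in EA; set D := spectral_diag A in EA Dr.
have uP : P \in unitmx by exact: spectral_unit.
pose d i := complex.Re (D 0 i).
have dE i : D 0 i = f (d i).
  by rewrite /f /= RRe_real //; exact: (mxOverP Dr).
exists [seq d i | i <- enum 'I_n].
have simA B C : \tr (invmx P *m B *m P *m (invmx P *m C *m P)) = \tr (B *m C).
  by rewrite !mulmxA mulmxK // mxtrace_mulC !mulmxA mulmxV // mul1mx.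
split; last 2 first.
- apply: (@complexI R); rewrite -/f -trace_map_mx -/A big_map big_enum /= rmorph_sum.
  rewrite EA mxtrace_mulC mulmxA mulmxV // mul1mx mxtrace_diag.
  by apply: eq_bigr => i _; rewrite dE.
- apply: (@complexI R); rewrite -/f -trace_map_mx map_mxM -/A big_map big_enum /= rmorph_sum.
  rewrite EA simA mulmx_diag mxtrace_diag.
  by apply: eq_bigr => i _; rewrite !mxE dE rmorphXn.
- apply: (@map_poly_inj _ _ f).
  rewrite map_char_poly -/A rmorph_prod big_map big_enum /=.
  rewrite EA char_poly_conj //.
  rewrite char_poly_trig ?diag_mx_is_trig //.
  apply: eq_bigr => i _; rewrite !mxE eqxx mulr1n dE.
  by rewrite rmorphB /= map_polyX map_polyC.
Qed.

Lemma elem_sym2E (R : realType) (s : seq R) :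
  elem_sym2 s = ((\sum_(t <- s) t) ^+ 2 - \sum_(t <- s) t ^+ 2) / 2.
Proof.
have E := @sum_pairs_symm R (size s) (fun i j => s`_i * s`_j) (fun i j => mulrC _ _).
have sumE (f : R -> R) : \sum_(t <- s) f t = \sum_(i < size s) f s`_i.
  by rewrite (big_nth 0) big_mkord.
rewrite /elem_sym2 (sumE id) (sumE (fun t => t ^+ 2)) expr2 big_distrlr /= E.
under [X in X + _ - _]eq_bigr do rewrite -expr2.
by rewrite addrAC subrr add0r mulrAC divff ?mul1r // pnatr_eq0.
Qed.

(** The matrices [invmx h *m A] and [S] are similar, because [invmx h] equals
    [E^T *m E]. Hence they have the same characteristic polynomial; it splits
    since [S] is symmetric, and unique factorization identifies the list of
    roots chosen in [eigenvalues] with the spectrum of [S], up to order. *)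
Lemma sigma2_frame (R : realType) n (h E A : 'M[R]_n) (S := E *m A *m E^T) :
  Defs.orthonormal h E -> A^T = A ->
  elem_sym2 (eigenvalues (invmx h *m A))
  = ((\tr S) ^+ 2 - \sum_b \sum_d S b d ^+ 2) / 2.
Proof.
move=> hE symA.
have symS : S^T = S by rewrite !trmx_mul trmxK symA mulmxA.
have uE : E^T \in unitmx.
  by move: hE; rewrite /Defs.orthonormal => /mulmx1_unit[].
have -> : invmx h *m A = invmx (invmx E^T) *m S *m invmx E^T.
  by rewrite (orthonormal_invmx hE) invmxK /S !mulmxA mulmxK.
have uE' : invmx E^T \in unitmx by rewrite unitmx_inv.
have [s [charS sum1 sum2]] := symmetric_char_poly_split symS.
have charE : char_poly (invmx (invmx E^T) *m S *m invmx E^T)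
    = \prod_(t <- s) ('X - t%:P) by rewrite char_poly_conj.
have eigP : char_poly (invmx (invmx E^T) *m S *m invmx E^T)
    = \prod_(t <- eigenvalues (invmx (invmx E^T) *m S *m invmx E^T)) ('X - t%:P).
  exact: (@xgetPex _ [::] [set r : seq R | char_poly _ = \prod_(t <- r) ('X - t%:P)]
    (ex_intro _ s charE)).
have perm_s := prod_XsubC_eq (etrans (esym eigP) charE).
rewrite elem_sym2E !(perm_big _ perm_s) /= sum1 sum2; congr ((_ - _) / _).
apply: eq_bigr => b _; rewrite mxE; apply: eq_bigr => d _.
have Sdb : S d b = S b d by rewrite -[in LHS]symS [LHS]mxE.
by rewrite Sdb expr2.
Qed.

(** * Orthogonality of the Weyl and Schouten parts *)

Definition ricci_contraction (R : realType) (n : nat) (T : tensor4 R n) : 'M[R]_n :=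
  \matrix_(b, d) \sum_a T a b a d.

Definition tensor4_dot (R : realType) (n : nat) (S T : tensor4 R n) : R :=
  \sum_(a < n) \sum_(b < n) \sum_(c < n) \sum_(d < n) S a b c d * T a b c d.

(** An ordered pair of indices i < j stands for the two entries (i, j) and
    (j, i), once in each of the two pairs: whence the factor 4. *)
Lemma normsq22E (R : realType) n (E : 'M[R]_n) (T : tensor4 R n) :
  bivector_antisym (frame4 E T) ->
  normsq22 E T = 4^-1 * tensor4_dot (frame4 E T) (frame4 E T).
Proof.
rewrite /normsq22 /tensor4_dot; set X := frame4 E T => -[X12 X34].
have anti0 (x : R) : x = - x -> x = 0 by move=> ?; lra.
have half a b : \sum_(c < n) \sum_(d < n) X a b c d * X a b c d
    = 2 * \sum_(c < n) \sum_(d < n | (c < d)%N) X a b c d ^+ 2.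
  rewrite sum_pairs_symm; last by move=> c d; rewrite X34; ring.
  by rewrite big1 ?add0r // => c _; rewrite (anti0 _ (X34 a b c c)) mul0r.
have -> : \sum_(a < n) \sum_(b < n) \sum_(c < n) \sum_(d < n) X a b c d * X a b c d
    = 2 * (2 * \sum_(a < n) \sum_(b < n | (a < b)%N)
            \sum_(c < n) \sum_(d < n | (c < d)%N) X a b c d ^+ 2).
  under eq_bigr => a _ do under eq_bigr => b _ do rewrite half.
  rewrite sum_pairs_symm.
    rewrite big1 ?add0r; last first.
      move=> a _; rewrite big1 ?mulr0 // => c _; rewrite big1 // => d _.
      by rewrite (anti0 _ (X12 a a c d)) expr0n.
    congr (2 * _); rewrite mulr_sumr; apply: eq_bigr => a _.
    by rewrite mulr_sumr.
  move=> a b; congr (2 * _); apply: eq_bigr => c _; apply: eq_bigr => d _.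
  by rewrite X12 sqrrN.
by field.
Qed.

Lemma sum_delta (R : nzRingType) n (a : 'I_n) (F : 'I_n -> R) :
  \sum_c (1%:M : 'M[R]_n) a c * F c = F a.
Proof.
rewrite (bigD1 a) //= mxE eqxx mul1r big1 ?addr0 // => c ca.
by rewrite mxE eq_sym (negbTE ca) mul0r.
Qed.

(** The product with the metric is adjoint to the contraction. Each of the four
    terms of the Kulkarni-Nomizu product contributes the same amount, because
    the antisymmetries of [X] make up for the signs. In particular a tensor
    with zero contraction is orthogonal to every product with the metric. *)
Lemma dot_kn_prod (R : realType) n (X : tensor4 R n) (B : 'M[R]_n) :
  bivector_antisym X ->
  tensor4_dot X (kn_prod 1%:M B) = 4 * \sum_b \sum_d ricci_contraction X b d * B b d.
Proof.
move=> [X12 X34].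
pose I1 : 'M[R]_n := 1%:M.
pose K := \sum_b \sum_d ricci_contraction X b d * B b d.
have K1 : \sum_a \sum_b \sum_c \sum_d X a b c d * (I1 a c * B b d) = K.
  rewrite exchange_big; apply: eq_bigr => b _ /=.
  under [RHS]eq_bigr do rewrite mxE mulr_suml.
  rewrite [RHS]exchange_big; apply: eq_bigr => a _ /=.
  rewrite exchange_big; apply: eq_bigr => d _ /=.
  rewrite -[RHS](sum_delta a (fun c => X a b c d * B b d)).
  by apply: eq_bigr => c _; ring.
have K2 : \sum_a \sum_b \sum_c \sum_d X a b c d * (I1 b d * B a c) = K.
  rewrite -K1 exchange_big; apply: eq_bigr => b _; apply: eq_bigr => a _ /=.
  rewrite exchange_big; apply: eq_bigr => d _; apply: eq_bigr => c _ /=.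
  by rewrite X12 X34 opprK.
have K3 : \sum_a \sum_b \sum_c \sum_d X a b c d * (I1 a d * B b c) = - K.
  rewrite -K1 -sumrN; apply: eq_bigr => a _; rewrite -sumrN; apply: eq_bigr => b _ /=.
  rewrite exchange_big -sumrN; apply: eq_bigr => d _; rewrite -sumrN; apply: eq_bigr => c _ /=.
  by rewrite X34 mulNr.
have K4 : \sum_a \sum_b \sum_c \sum_d X a b c d * (I1 b c * B a d) = - K.
  rewrite -K2 -sumrN; apply: eq_bigr => a _; rewrite -sumrN; apply: eq_bigr => b _ /=.
  rewrite exchange_big -sumrN; apply: eq_bigr => d _; rewrite -sumrN; apply: eq_bigr => c _ /=.
  by rewrite X34 mulNr.
transitivity (K + K - (- K) - (- K)); last by rewrite -/K; ring.
rewrite -{1}K1 -{1}K2 -{1}K3 -K4 /tensor4_dot -!sumrN -!big_split; apply: eq_bigr => a _ /=.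
rewrite -!sumrN -!big_split; apply: eq_bigr => b _ /=.
rewrite -!sumrN -!big_split; apply: eq_bigr => c _ /=.
rewrite -!sumrN -!big_split; apply: eq_bigr => d _ /=.
by rewrite /kn_prod -/I1; ring.
Qed.

Lemma kn_prod_antisym (R : realType) n (h k : 'M[R]_n) : bivector_antisym (kn_prod h k).
Proof. by split=> i j r s; rewrite /kn_prod; ring. Qed.

Lemma ricci_contraction_kn_prod (R : realType) n (B : 'M[R]_n) :
  ricci_contraction (kn_prod 1%:M B) = (n%:R - 2) *: B + (\tr B)%:M.
Proof.
apply/matrixP => b d; rewrite !mxE.
transitivity (\sum_a (B b d + (1%:M : 'M[R]_n) b d * B a a
    - (1%:M : 'M[R]_n) d a * B b a - (1%:M : 'M[R]_n) b a * B a d)).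
  apply: eq_bigr => a _; rewrite /kn_prod !mxE eqxx mulr1n (eq_sym a d); ring.
rewrite !sumrB big_split /= sumr_const card_ord -mulr_sumr !sum_delta !mxE.
rewrite -mulr_natl /mxtrace -[X in _ = _ + X]mulr_natl; ring.
Qed.

(** Pythagoras: by [ricci_contraction_kn_prod] the hypothesis says that [W] has
    zero contraction, so [W] is orthogonal to the product of the metric and [B]
    by [dot_kn_prod]; the last term is the squared norm of this product. *)
Lemma dot_add_kn_prod (R : realType) n (X W : tensor4 R n) (B : 'M[R]_n) :
  bivector_antisym X ->
  (forall a b c d, W a b c d = X a b c d - kn_prod 1%:M B a b c d) ->
  ricci_contraction X = (n%:R - 2) *: B + (\tr B)%:M ->
  tensor4_dot X X = tensor4_dot W W
    + 4 * ((n%:R - 2) * \sum_b \sum_d B b d ^+ 2 + (\tr B) ^+ 2).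
Proof.
move=> aX WE cX.
set K := kn_prod 1%:M B in WE.
have -> : tensor4_dot X X = tensor4_dot W W + (2 * tensor4_dot X K - tensor4_dot K K).
  rewrite /tensor4_dot mulr_sumr -sumrB -big_split; apply: eq_bigr => a _ /=.
  rewrite mulr_sumr -sumrB -big_split; apply: eq_bigr => b _ /=.
  rewrite mulr_sumr -sumrB -big_split; apply: eq_bigr => c _ /=.
  rewrite mulr_sumr -sumrB -big_split; apply: eq_bigr => d _ /=.
  by rewrite WE; ring.
rewrite !dot_kn_prod //; last exact: kn_prod_antisym.
rewrite ricci_contraction_kn_prod cX; congr (_ + _).
(* Both inner products equal 4 * S: the one of X with K and the one of K with K. *)
set S := \sum_b _; have -> : S = (n%:R - 2) * (\sum_b \sum_d B b d ^+ 2) + \tr B ^+ 2.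
  rewrite /S mulr_sumr expr2 {3}/mxtrace mulr_sumr -big_split; apply: eq_bigr => b _ /=.
  rewrite -[X in _ + _ * X](sum_delta b (fun d => B b d)).
  rewrite !mulr_sumr -big_split; apply: eq_bigr => d _ /=.
  by rewrite !mxE -mulr_natl; ring.
ring.
Qed.

Lemma ricci_normsq (R : comNzRingType) n (B rho : 'M[R]_n) :
  rho = (n%:R - 2) *: B + (\tr B)%:M ->
  \sum_b \sum_d rho b d ^+ 2
  = (n%:R - 2) ^+ 2 * \sum_b \sum_d B b d ^+ 2 + (3 * n%:R - 4) * (\tr B) ^+ 2.
Proof.
move=> ->.
transitivity (\sum_b ((n%:R - 2) ^+ 2 * (\sum_d B b d ^+ 2)
   + 2 * (n%:R - 2) * \tr B * B b b + \tr B ^+ 2)).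
  apply: eq_bigr => b _; move: (\tr B) => t.
  rewrite -[B b b](sum_delta b (fun d => B b d)).
  rewrite -[X in _ = _ + X](sum_delta b (fun d => t ^+ 2)).
  rewrite !mulr_sumr -!big_split; apply: eq_bigr => d _ /=.
  rewrite !mxE; case: (b == d); rewrite ?mulr1n ?mulr0n; ring.
rewrite !big_split /= -!mulr_sumr sumr_const card_ord -mulr_natl.
rewrite -/(mxtrace B); ring.
Qed.

(** Taking traces in the definition of the Schouten tensor gives its trace, and
    then the Ricci tensor. *)
Lemma schouten_inversion (R : realFieldType) n (A rho : 'M[R]_n) :
  n%:R - 2 != 0 :> R -> n%:R - 1 != 0 :> R ->
  A = (n%:R - 2)^-1 *: (rho - (\tr rho / (2 * (n%:R - 1))) *: 1%:M) ->
  rho = (n%:R - 2) *: A + (\tr A)%:M /\ \tr rho = 2 * (n%:R - 1) * \tr A.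
Proof.
move=> n2 n1 AE.
have trE : \tr rho = 2 * (n%:R - 1) * \tr A.
  rewrite AE mxtraceZ linearB /= mxtraceZ mxtrace1.
  by move: (\tr rho) => t; field; rewrite n1 n2.
split=> //.
rewrite {1}AE scalerA divff // scale1r trE scalemx1.
have -> : 2 * (n%:R - 1) * \tr A / (2 * (n%:R - 1)) = \tr A.
  by move: (\tr A) => t; field.
by rewrite subrK.
Qed.

Lemma normsq22_ge0 (R : realType) n (E : 'M[R]_n) (T : tensor4 R n) :
  0 <= normsq22 E T.
Proof. by do 4!apply: sumr_ge0 => ? _; exact: sqr_ge0. Qed.

(** * The Gauss-Bonnet curvature *)

Lemma posdef_unitmx (R : numFieldType) n (G : 'M[R]_n) :
  (forall v : 'rV[R]_n, v != 0 -> 0 < (v *m G *m v^T) 0 0) -> G \in unitmx.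
Proof.
move=> posG; rewrite -row_free_unit -kermx_eq0; apply/rowV0P => v /sub_kermxP vG.
by apply/eqP/negPn/negP => /posG; rewrite vG mul0mx mxE ltxx.
Qed.

Theorem proposition3p3 (R : realType) (n : nat) (hn : (4 <= n)%N)
    (M : smooth_manifold R n) (g : riemannian_metric M)
    (c : chart R n M) (hc : atlas c) (p : M) (hp : dom c p)
    (E : 'M[R]_n) (hE : orthonormal_basis g c p E) :
  h4 g c p E = weyl_normsq g c p E
               + 2 * (n%:R - 2) * (n%:R - 3) * sigma2 g c p
  /\ (0 < sigma2 g c p -> 0 < h4 g c p E)
  /\ (0 <= sigma2 g c p -> 0 <= h4 g c p E).
Proof.
have n4 : 4 <= n%:R :> R by rewrite (ler_nat R 4 n).
suff main : h4 g c p E = weyl_normsq g c p E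
               + 2 * (n%:R - 2) * (n%:R - 3) * sigma2 g c p.
  have w0 : 0 <= weyl_normsq g c p E by exact: normsq22_ge0.
  have n23 : 0 < 2 * (n%:R - 2) * (n%:R - 3) :> R by rewrite !mulr_gt0 //; lra.
  split=> //; rewrite main; split=> s0.
    by rewrite ltr_wpDl // mulr_gt0.
  by rewrite addr_ge0 // mulr_ge0 // ltW.
set x := Defs.coord c p.
have Ux : (Defs.coord c @` dom c) x by exists p.
have uG y : (Defs.coord c @` dom c) y -> g c y \in unitmx.
  by move=> Uy; apply: posdef_unitmx; exact: metric_posdef.
have pairR i j k l := riemann_pair_sym (@image_open _ _ _ c) (metric_smooth g hc)
  (Defs.metric_sym g hc) uG i j k l Ux.
set Rm := riemann (g c) x in pairR *.
have aR : bivector_antisym Rm.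
  have a12 i j k l : Rm j i k l = - Rm i j k l by exact: riemann_antisym12.
  by split=> // i j k l; rewrite pairR a12 -pairR.
have symRic : (ricci (g c) x)^T = ricci (g c) x.
  by apply: ricci_sym; [exact: (Defs.metric_sym g hc)|exact: pairR].
have gE : E *m g c x *m E^T = 1%:M := hE.
set rho := E *m ricci (g c) x *m E^T.
have ginv : invmx (g c x) = E^T *m E := orthonormal_invmx hE.
have rhoE : ricci_contraction (frame4 E Rm) = rho.
  by apply/matrixP => b d; rewrite mxE frame4_trace -ginv.
have scalE : scal (g c) x = \tr rho.
  rewrite /rho mxtrace_mulC mulmxA -ginv /mxtrace /scal.
  apply: eq_bigr => j _; rewrite mxE; apply: eq_bigr => l _.
  by rewrite -[in RHS]symRic [in RHS]mxE.
set A := E *m schouten (g c) x *m E^T.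
have AE : A = (n%:R - 2)^-1 *: (rho - (\tr rho / (2 * (n%:R - 1))) *: 1%:M).
  rewrite /A /schouten scalE -scalemxAr -scalemxAl mulmxBr mulmxBl.
  by rewrite -scalemxAr -scalemxAl gE.
have symA : (schouten (g c) x)^T = schouten (g c) x.
  by rewrite /schouten linearZ linearB linearZ /= symRic (Defs.metric_sym g hc Ux).
have n2 : n%:R - 2 != 0 :> R by apply: lt0r_neq0; lra.
have n1 : n%:R - 1 != 0 :> R by apply: lt0r_neq0; lra.
have [rhoA trrho] := schouten_inversion n2 n1 AE.
have WE a b k d : frame4 E (weyl (g c) x) a b k d
    = frame4 E Rm a b k d - kn_prod 1%:M A a b k d.
  by rewrite /weyl frame4D frame4N frame4_kn_prod gE.
have aX := frame4_antisym E aR.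
have aW : bivector_antisym (frame4 E (weyl (g c) x)).
  have [[X12 X34] [K12 K34]] := (aX, kn_prod_antisym 1%:M A).
  split=> i j k l; rewrite !WE.
    by rewrite (X12 i j k l) (K12 i j k l) opprK opprB addrC.
  by rewrite (X34 i j k l) (K34 i j k l) opprK opprB addrC.
rewrite /h4 /weyl_normsq /sigma2 -/x (sigma2_frame hE symA) -/A scalE trrho.
rewrite (normsq22E aX) (normsq22E aW) -/Rm.
rewrite (dot_add_kn_prod aX WE (etrans rhoE rhoA)).
rewrite /normsq11 -/rho (ricci_normsq rhoA).
by field.
Qed.
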